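(* Let $n\ge 3$ and $1\le k<n$ be integers. The average squared radius of gyration of a subsegment of length $k$, taken over all such subsegments in all $P\in\mathcal{P}_n$, is $$R_{G,n,k}^2=\frac{(k^2-1)(2n-k)}{12k(n-1)}.$$
   Context: An ideal ring $P$ of length $n$ is an $n$-edged equilateral polygon embedded in $\mathbb{R}^3$ with one vertex at the origin, given by unit vectors (edge vectors) $e_1,\dots,e_n\in\mathbb{R}^3$ with $\sum_{i=1}^n e_i=0$; its $k$-th vertex is $v_k=\sum_{i=1}^k e_i$. The space of all such $P$ is $\mathcal{P}_n$. Averages over $\mathcal{P}_n$ are expectations with respect to a fixed probability measure on $\mathcal{P}_n$ under which the edge vectors $e_1,\dots,e_n$ are identically distributed and, for $i\ne j$, the distribution of $e_i\cdot e_j$ does not depend on $i$ and $j$ (standing assumption). Indices of edge vectors are read modulo $n$. For $P\in\mathcal{P}_n$ and $1\le i\le n$, $P_{i,k}$ is the translated subsegment of $P$ of length $k$ beginning with the edge vector $e_i$: it starts at the origin and its edge vectors are $e_m'=e_{i+m-1}$, $1\le m\le k$, so its $j$-th vertex is $v_j'=\sum_{m=1}^{j}e_m'$, $1\le j\le k$. Its translated center of mass is $c_{P_{i,k}}=\frac1k\sum_{j=1}^k v_j'$, and its squared radius of gyration is $$R_G^2(P_{i,k})=\frac1k\sum_{j=1}^k\|v_j'-c_{P_{i,k}}\|^2 .$$ Set $R_{G,k}^2(P)=\frac1n\sum_{i=1}^n R_G^2(P_{i,k})$. Then $R_{G,n,k}^2$ is the average of $R_{G,k}^2(P)$ over $P\in\mathcal{P}_n$.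 *)

(* Defs.v *)
From HB Require Import structures.
From mathcomp Require Import all_boot all_order all_algebra.
From mathcomp Require Import all_classical all_reals all_analysis.
From mathcomp Require Import ring.

Set Implicit Arguments.
Unset Strict Implicit.
Unset Printing Implicit Defensive.

Import Order.TTheory GRing.Theory Num.Theory.
Import numFieldNormedType.Exports.

Local Open Scope classical_set_scope.
Local Open Scope ring_scope.

Definition dot (R : realType) (u v : 'rV[R]_3) : R := \sum_(j < 3) u 0 j * v 0 j.

(* The library norm `|u| on row vectors is the sup norm. *)
Definition enorm (R : realType) (u : 'rV[R]_3) : R := Num.sqrt (dot u u).

(* The i-th row of the matrix is the i-th edge vector. *)
Definition ideal_rings (R : realType) (n : nat) : set 'M[R]_(n, 3) :=
  [set e | (forall i : 'I_n, enorm (row i e) = 1) /\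
           \sum_(i < n) row i e = 0].
Arguments ideal_rings : clear implicits.

Lemma ideal_rings_nonempty (R : realType) (n : nat) : (3 <= n)%N ->
  exists e : 'M[R]_(n, 3), e \in ideal_rings R n.
Proof.
move=> n3.
suff [e [e1 e0]] : exists e : nat -> 'rV[R]_3,
    (forall i, enorm (e i) = 1) /\ \sum_(i < n) e i = 0.
  exists (\matrix_(i < n) e i); rewrite inE; split => [i|]; first by rewrite rowK.
  by rewrite -[RHS]e0; apply: eq_bigr => i _; rewrite rowK.
pose u (a b : R) : 'rV[R]_3 :=
  \row_(j < 3) (if j == 0 :> nat then a else if j == 1 :> nat then b else 0).
have dotu a b : dot (u a b) (u a b) = a ^+ 2 + b ^+ 2.
  rewrite /dot !big_ord_recl big_ord0 !mxE /=; ring.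
have nu a b : a ^+ 2 + b ^+ 2 = 1 -> enorm (u a b) = 1.
  by move=> ab; rewrite /enorm dotu ab sqrtr1.
have step m : (exists e : nat -> 'rV[R]_3,
    (forall i, enorm (e i) = 1) /\ \sum_(i < m) e i = 0) ->
    exists e : nat -> 'rV[R]_3,
    (forall i, enorm (e i) = 1) /\ \sum_(i < m.+2) e i = 0.
  move=> [e [e1 e0]].
  exists (fun i => if i is j.+1 then if j is l.+1 then e l else u (-1) 0
                   else u 1 0); split.
    move=> [|[|i]] //; apply: nu; ring.
  rewrite !big_ord_recl /= e0 addr0.
  by apply/rowP => j; rewrite !mxE; case: ifP; rewrite ?addrN //; case: ifP;
    rewrite addr0.
elim/ltn_ind: n n3 => -[|[|[|[|[|n]]]]] //= IH _.
- pose s : R := Num.sqrt 3 / 2.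
  have s2 : s ^+ 2 = 3 / 4.
    by rewrite /s expr_div_n sqr_sqrtr ?ler0n //; by field.
  exists (fun i => if i == 0 then u 1 0 else if i == 1 then u (- 2^-1) s
                   else u (- 2^-1) (- s)); split.
    move=> i; case: ifP => _; [|case: ifP => _]; apply: nu;
      rewrite ?sqrrN ?s2; by field.
  rewrite !big_ord_recl big_ord0 /=; apply/rowP => j; rewrite !mxE.
  case: ifP => _; first by field.
  by case: ifP => _; ring.
- apply/step/step.
  by exists (fun=> u 1 0); split; [move=> i; apply: nu; ring|rewrite big_ord0].
- by apply/step/IH.
Qed.

(* Measurable types are inhabited by definition; hn provides this. *)
Definition ideal_ring (R : realType) (n : nat) (hn : (3 <= n)%N) : Type :=
  set_type (ideal_rings R n).

Section ideal_ring_structure.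
Variables (R : realType) (n : nat) (hn : (3 <= n)%N).

(* Subspace topology from 'M[R]_(n, 3). *)
HB.instance Definition _ :=
  Topological.copy (ideal_ring R hn) (set_type (ideal_rings R n)).

Let ideal_ring_point : ideal_ring R hn :=
  let (e, he) := cid (ideal_rings_nonempty R hn) in
  exist (fun e => e \in ideal_rings R n) e he.

HB.instance Definition _ := isPointed.Build (ideal_ring R hn) ideal_ring_point.

End ideal_ring_structure.

Definition borel (T : ptopologicalType) := g_sigma_algebraType (@open T).

Definition identically_distributed (d d' : measure_display)
    (T : measurableType d) (T' : measurableType d') (R : realType)
    (mu : probability T R) (X Y : T -> T') : Prop :=
  forall A : set T', measurable A -> mu (X @^-1` A) = mu (Y @^-1` A).

Section gyration.
Variables (R : realType) (n : nat) (hn : (3 <= n)%N).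
Implicit Types (P : ideal_ring R hn) (i : 'I_n) (e : nat -> 'rV[R]_3).

Definition edge i P : 'rV[R]_3 := row i (set_val P).

(* The edge vectors e'_1, e'_2, ... of P_{i,k} are subsegment P i 0,
   subsegment P i 1, ...; ordS is the successor modulo n. *)
Definition subsegment P i : nat -> 'rV[R]_3 :=
  fun m => edge (iter m (@ordS n) i) P.

Definition vertex e (j : nat) : 'rV[R]_3 := \sum_(0 <= m < j) e m.

Definition center_of_mass e (k : nat) : 'rV[R]_3 :=
  k%:R^-1 *: \sum_(1 <= j < k.+1) vertex e j.

Definition gyration2 e (k : nat) : R :=
  k%:R^-1 * \sum_(1 <= j < k.+1) enorm (vertex e j - center_of_mass e k) ^+ 2.

Definition mean_gyration2 (k : nat) P : R :=
  n%:R^-1 * \sum_(i < n) gyration2 (subsegment P i) k.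

End gyration.

(* Main.v *)
Require Import Defs.
From HB Require Import structures.
From mathcomp Require Import all_boot all_order all_algebra.
From mathcomp Require Import all_classical all_reals all_analysis.
From mathcomp Require Import ring lra.

Import Order.TTheory GRing.Theory Num.Theory.
Import numFieldNormedType.Exports.

Local Open Scope classical_set_scope.
Local Open Scope ring_scope.

(** Taking the mean of squared distances only involves the scalar products of
    pairs of edges, and these have two possible means. An edge has
    [dot e e = 1]. Two distinct edges have a common mean product [c], which the
    closing condition determines: taking the product of [\sum_j e_j = 0] with
    [e_i] and then the mean gives [1 + (n - 1) * c = 0]
    ([has_mean_dot_edge]).

    The squared radius of gyration of a segment with edges [e_0, ..., e_(k-1)]
    is a quadratic form [\sum_(m, l) q_ml * dot (e_m) (e_l)], whose
    coefficients depend on [k] alone ([gyration2_dot]). Since [k < n], the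
    edges of a segment are distinct edges of the ring ([eq_iter_ordS]), so the
    mean of the form is [\sum_(m, l) q_ml * (if m == l then 1 else c)], that is,
    [(1 - c) * \sum_m q_mm + c * \sum_(m, l) q_ml] ([sum_weight_form]).

    Both coefficients are variances over a uniform index [j] in [1, ..., k]:
    [\sum_(m, l) q_ml] is the gyration of a straight segment, the variance
    [(k^2 - 1) / 12] of [j] itself ([sum_weight]), and [\sum_m q_mm] is the
    gyration of a segment with orthonormal edges, the sum over [m] of the
    variances of the indicators of [m < j], which is [(k^2 - 1) / (6 * k)]
    ([sum_weight_sqr]). Substituting [c = - (n - 1)^-1] gives the formula.

    What remains is analytic: the products [dot (e_i) (e_j)] are continuous,
    hence measurable for the Borel sets, and bounded by 1, hence integrable;
    so means are linear, and equal laws give equal means. *)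

(** * Finite sums *)

Lemma sum_natr (R : realType) (k : nat) :
  \sum_(m < k) m%:R = k%:R * (k%:R - 1) / 2 :> R.
Proof.
by elim: k => [|k IH]; [rewrite big_ord0 !mul0r | rewrite big_ord_recr /= IH; field].
Qed.

Lemma sum_natr_sqr (R : realType) (k : nat) :
  \sum_(m < k) m%:R ^+ 2 = k%:R * (k%:R - 1) * (2 * k%:R - 1) / 6 :> R.
Proof.
by elim: k => [|k IH]; [rewrite big_ord0 !mul0r | rewrite big_ord_recr /= IH; field].
Qed.

Lemma sum_ltn_natr (R : realType) (j k : nat) : (j <= k)%N ->
  \sum_(m < k) (m < j)%:R = j%:R :> R.
Proof.
move=> jk; have := @big_ord_widen R 0 +%R j k (fun=> 1) jk.
rewrite sumr_const card_ord => ->; rewrite [RHS]big_mkcond.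
by apply: eq_bigr => m _; case: ifP.
Qed.

Lemma sum_natr_leq (R : realType) (m k : nat) : (m <= k)%N ->
  \sum_(j < k) (m <= j)%:R = k%:R - m%:R :> R.
Proof.
move=> mk; rewrite -[in RHS](sum_ltn_natr R _ _ mk) -[k in k%:R]card_ord -sumr_const -sumrB.
by apply: eq_bigr => j _; rewrite ltnNge; case: (m <= j)%N; rewrite ?subr0 ?subrr.
Qed.

(** * Gyration as a quadratic form in the edges *)

Section deviation_weights.
Variable R : realType.
Implicit Types (u v : 'rV[R]_3) (e : nat -> 'rV[R]_3) (k j m : nat).

(** The coefficient of the edge [e m] in the deviation of the [j]-th vertex from
    the center of mass: edge [m] occurs in vertex [j] when [m < j], thus in
    [k - m] of the [k] vertices. *)
Definition weight k j m : R := (m < j)%:R - (1 - m%:R / k%:R).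

Lemma dot_ge0 u : 0 <= dot u u.
Proof. by apply: sumr_ge0 => i _; rewrite -expr2 sqr_ge0. Qed.

Lemma enorm_sqr u : enorm u ^+ 2 = dot u u.
Proof. by rewrite /enorm sqr_sqrtr ?dot_ge0. Qed.

Lemma dot_suml (I : Type) (s : seq I) (a : I -> 'rV[R]_3) v :
  dot (\sum_(i <- s) a i) v = \sum_(i <- s) dot (a i) v.
Proof.
rewrite /dot exchange_big; apply: eq_bigr => j _.
by rewrite summxE mulr_suml.
Qed.

Lemma dotC u v : dot u v = dot v u.
Proof. by apply: eq_bigr => j _; rewrite mulrC. Qed.

Lemma dot_sumr (I : Type) (s : seq I) (a : I -> 'rV[R]_3) v :
  dot v (\sum_(i <- s) a i) = \sum_(i <- s) dot v (a i).
Proof. by rewrite dotC dot_suml; apply: eq_bigr => i _; rewrite dotC. Qed.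

Lemma dotZ (a b : R) u v : dot (a *: u) (b *: v) = a * b * dot u v.
Proof. by rewrite /dot mulr_sumr; apply: eq_bigr => j _; rewrite !mxE; ring. Qed.

Lemma vertex_steps e k j : (j <= k)%N ->
  vertex e j = \sum_(m < k) (m < j)%:R *: e m.
Proof.
move=> jk; rewrite /vertex big_mkord (big_ord_widen _ _ jk) big_mkcond.
by apply: eq_bigr => m _; case: ifP; rewrite ?scale1r ?scale0r.
Qed.

Lemma vertex_sub_center e k j : (0 < k)%N -> (j <= k)%N ->
  vertex e j - center_of_mass e k = \sum_(m < k) weight k j m *: e m.
Proof.
move=> k0 jk; rewrite (vertex_steps _ _ _ jk).
have -> : center_of_mass e k = \sum_(m < k) (1 - m%:R / k%:R) *: e m.
  rewrite /center_of_mass big_add1 /= big_mkord.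
  under [X in _ *: X]eq_bigr => i _ do rewrite (vertex_steps _ _ _ (ltn_ord i)).
  rewrite exchange_big scaler_sumr /=; apply: eq_bigr => m _.
  rewrite -scaler_suml scalerA; congr (_ *: _).
  under eq_bigr do rewrite ltnS.
  rewrite sum_natr_leq 1?ltnW //.
  by field; rewrite pnatr_eq0 -lt0n.
by rewrite -sumrB; apply: eq_bigr => m _; rewrite -scalerBl.
Qed.

Lemma gyration2_dot e k : (0 < k)%N ->
  gyration2 e k = k%:R^-1 * \sum_(j < k) \sum_(m < k) \sum_(l < k)
    weight k j.+1 m * weight k j.+1 l * dot (e m) (e l).
Proof.
move=> k0; rewrite /gyration2 big_add1 /= big_mkord; congr (_ * _).
apply: eq_bigr => j _.
rewrite enorm_sqr vertex_sub_center // dot_suml; apply: eq_bigr => m _.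
by rewrite dot_sumr; apply: eq_bigr => l _; rewrite dotZ.
Qed.

(** When all edges are equal, the deviation of vertex [j] is the deviation of [j]
    from the mean [(k + 1) / 2] of [1, ..., k]. *)
Lemma sum_weight k j : (0 < k)%N -> (j <= k)%N ->
  \sum_(m < k) weight k j m = j%:R - (k%:R + 1) / 2.
Proof.
move=> k0 jk; rewrite /weight !sumrB sum_ltn_natr // -mulr_suml sum_natr.
by rewrite sumr_const card_ord; field; rewrite pnatr_eq0 -lt0n.
Qed.

(** Up to the factor [k], this is the variance [p * (1 - p)] of an event of
    probability [p = 1 - m / k]. *)
Lemma sum_weight_sqr k m : (0 < k)%N -> (m <= k)%N ->
  \sum_(j < k) weight k j.+1 m ^+ 2 = m%:R * (1 - m%:R / k%:R).
Proof.
move=> k0 mk.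
(* an indicator is its own square, so the summand is affine in it *)
pose p : R := 1 - m%:R / k%:R.
have E (j : 'I_k) :
    weight k j.+1 m ^+ 2 = (1 - 2 * p) * (m <= j)%:R + p ^+ 2.
  by rewrite /weight ltnS -/p; case: (m <= j)%N => /=; ring.
under eq_bigr do rewrite E.
rewrite big_split /= -mulr_sumr sum_natr_leq // sumr_const card_ord /p.
by field; rewrite pnatr_eq0 -lt0n.
Qed.

(** Splitting the matrix with diagonal 1 and off-diagonal [c] as
    [(1 - c) * identity + c * all-ones] separates the orthonormal segment from
    the straight one. *)
Lemma sum_weight_form k (c : R) : (0 < k)%N ->
  k%:R^-1 * \sum_(j < k) \sum_(m < k) \sum_(l < k)
    weight k j.+1 m * weight k j.+1 l * (if m == l then 1 else c) =
  (1 - c) * ((k%:R ^+ 2 - 1) / (6 * k%:R)) + c * ((k%:R ^+ 2 - 1) / 12).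
Proof.
move=> k0; have k00 : k%:R != 0 :> R by rewrite pnatr_eq0 -lt0n.
have E (j : 'I_k) : \sum_(m < k) \sum_(l < k)
    weight k j.+1 m * weight k j.+1 l * (if m == l then 1 else c) =
    (1 - c) * (\sum_(m < k) weight k j.+1 m ^+ 2) +
    c * (j.+1%:R - (k%:R + 1) / 2) ^+ 2.
  rewrite -(sum_weight _ _ k0 (ltn_ord j)) mulr_sumr expr2 mulr_suml mulr_sumr.
  rewrite -big_split; apply: eq_bigr => m _ /=.
  rewrite mulr_sumr mulr_sumr (bigD1 m) //= [in RHS](bigD1 m) //= eqxx addrA.
  congr (_ + _); first ring.
  by apply: eq_bigr => l /negPf; rewrite eq_sym => ->; ring.
under eq_bigr do rewrite E.
rewrite big_split /= -!mulr_sumr exchange_big /=.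
under eq_bigr => m _ do
  rewrite sum_weight_sqr ?(ltnW (ltn_ord m)) // mulrBr mulr1 mulrA -expr2.
rewrite sumrB -mulr_suml sum_natr sum_natr_sqr.
have -> : \sum_(j < k) (j.+1%:R - (k%:R + 1) / 2) ^+ 2 =
    k%:R * (k%:R ^+ 2 - 1) / 12 :> R.
  have F (j : 'I_k) : (j.+1%:R - (k%:R + 1) / 2) ^+ 2 =
      j%:R ^+ 2 + (1 - k%:R) * j%:R + ((1 - k%:R) / 2) ^+ 2 :> R by field.
  under eq_bigr do rewrite F.
  rewrite !big_split /= -mulr_sumr sum_natr sum_natr_sqr sumr_const card_ord.
  by field.
by field.
Qed.

End deviation_weights.

(** * Means of random variables *)

Section means.
Context {d : measure_display} {T : measurableType d} {R : realType}.
Variable mu : probability T R.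
Implicit Types (X Y : T -> R) (x : R).

(** Integrability is part of the notion because the expectation is total and is
    linear only on integrable functions. *)
Definition has_mean X x :=
  mu.-integrable setT (EFin \o X) /\ 'E_mu[X]%E = x%:E.

Lemma has_meanZ X x (a : R) : has_mean X x ->
  has_mean (fun t => a * X t) (a * x).
Proof.
rewrite /has_mean expectation.unlock => -[iX EX]; split.
  exact: (integrableZl measurableT a iX).
by under eq_integral do rewrite EFinM; rewrite integralZl// EX EFinM.
Qed.

Lemma has_mean_sum (I : Type) (s : seq I) (X : I -> T -> R) (x : I -> R) :
  (forall i, has_mean (X i) (x i)) ->
  has_mean (fun t => \sum_(i <- s) X i t) (\sum_(i <- s) x i).
Proof.
rewrite /has_mean expectation.unlock => EX.
have iX i := (EX i).1.
split.
  have := integrable_sum measurableT s (P := xpredT) (fun i _ => iX i).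
  by apply: eq_integrable => // t _; rewrite /= sumEFin.
under eq_integral do rewrite -sumEFin.
rewrite integral_sum// -sumEFin; apply: eq_bigr => i _; exact: (EX i).2.
Qed.

Lemma has_mean_cst x : has_mean (fun=> x) x.
Proof.
split; last exact: expectation_cst.
exact: finite_measure_integrable_cst.
Qed.

Lemma has_mean_unique X x y : has_mean X x -> has_mean X y -> x = y.
Proof. by move=> [_ Xx] [_]; rewrite Xx => -[]. Qed.

Lemma has_mean_bounded X (M : R) : measurable_fun setT X ->
  (forall t, `|X t| <= M) -> has_mean X (fine 'E_mu[X]%E).
Proof.
move=> mX XM.
have iX : mu.-integrable setT (EFin \o X).
  apply: measurable_bounded_integrable => //.
    by rewrite -ge0_fin_numE // fin_num_measure.
  exists M; split; first by rewrite num_real.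
  by move=> N MN t _; apply: le_trans (ltW MN).
split=> //; rewrite fineK //.
by rewrite expectation.unlock; apply: integrable_fin_num.
Qed.

(** Both expectations are the integral of the identity against the law, which is
    the image measure of [mu] on [R]. *)
Lemma expectation_identically_distributed X Y :
  measurable_fun setT X -> measurable_fun setT Y ->
  mu.-integrable setT (EFin \o X) -> mu.-integrable setT (EFin \o Y) ->
  identically_distributed mu X Y -> 'E_mu[X]%E = 'E_mu[Y]%E.
Proof.
move=> mX mY iX iY XY; rewrite expectation.unlock.
transitivity (\int[pushforward mu X]_y y%:E)%E.
  by rewrite integral_pushforward ?preimage_setT.
transitivity (\int[pushforward mu Y]_y y%:E)%E.
  by apply: eq_measure_integral => A mA _; exact: XY.
by rewrite integral_pushforward ?preimage_setT.
Qed.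

End means.

(** * Scalar products of the edges of an ideal ring *)

(** The measurable sets of [R] are generated by the open intervals. *)
Lemma measurable_continuous_borel (T : ptopologicalType) (R : realType)
    (f : T -> R) : continuous f -> measurable_fun [set: borel T] f.
Proof.
move=> /continuousP cf.
apply: (measurability _ (measurable_realfun.RGenOpens.measurableE R)) => _ [_ [a [b ->] <-]].
by rewrite setTI; apply: sub_sigma_algebra; apply/cf/interval_open.
Qed.

Section edges.
Variables (R : realType) (n : nat) (hn : (3 <= n)%N).
Implicit Types (P : ideal_ring R hn) (i j : 'I_n).

Lemma dot_edge_diag i P : dot (edge i P) (edge i P) = 1.
Proof.
have [e1 _] : ideal_rings R n (set_val P) by apply: set_mem; apply: valP.
by rewrite -enorm_sqr /edge e1 expr1n.
Qed.

Lemma sum_dot_edge i P : \sum_j dot (edge i P) (edge j P) = 0.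
Proof.
have [_ e0] : ideal_rings R n (set_val P) by apply: set_mem; apply: valP.
rewrite -dot_sumr /edge e0 /dot big1 // => j _.
by rewrite [X in _ * X]mxE mulr0.
Qed.

(** Cauchy-Schwarz for unit vectors: expand the squares of [e_i + e_j] and
    [e_i - e_j], which are nonnegative. *)
Lemma dot_edge_le1 i j P : `|dot (edge i P) (edge j P)| <= 1.
Proof.
have H (s : R) : s ^+ 2 = 1 -> 0 <= 2 + 2 * s * dot (edge i P) (edge j P).
  move=> s1; have := dot_ge0 _ (edge i P + s *: edge j P).
  suff -> : dot (edge i P + s *: edge j P) (edge i P + s *: edge j P) =
    dot (edge i P) (edge i P) + 2 * s * dot (edge i P) (edge j P) +
    s ^+ 2 * dot (edge j P) (edge j P).
    by rewrite !dot_edge_diag s1; congr (_ <= _); ring.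
  rewrite /dot !mulr_sumr -!big_split; apply: eq_bigr => l _ /=.
  by rewrite !mxE; ring.
rewrite ler_norml.
have := H 1 (expr1n _ _); have := H (-1) (sqrr_sign R 1 : (-1) ^+ 2 = 1).
by move=> ? ?; apply/andP; split; lra.
Qed.

Lemma continuous_dot_edge i j :
  continuous (fun P => dot (edge i P) (edge j P)).
Proof.
have cc l a : continuous (fun P => edge l P 0 a).
  have -> : (fun P => edge l P 0 a) = (fun e : 'M[R]_(n, 3) => e l a) \o set_val.
    by apply/funext => P; rewrite /edge mxE.
  move=> P; apply: continuous_comp; last exact: coord_continuous.
  exact: initial_continuous.
apply: continuous_big => [|a _ P]; first exact: add_continuous.
by apply: cvgM; [exact: (nbhs_filter P) | exact: cc..].
Qed.

Lemma measurable_dot_edge i j :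
  measurable_fun [set: borel (ideal_ring R hn)]
    (fun P : ideal_ring R hn => dot (edge i P) (edge j P)).
Proof. exact: (measurable_continuous_borel _ _ _ (continuous_dot_edge i j)). Qed.

Lemma subr1_neq0 : n%:R - 1 != 0 :> R.
Proof. by rewrite subr_eq0 pnatr_eq1 gtn_eqF // (leq_trans _ hn). Qed.

Lemma val_iter_ordS i m : iter m (@ordS n) i = ((i + m) %% n)%N :> nat.
Proof.
elim: m => [|m IH] /=; first by rewrite addn0 modn_small.
by rewrite IH addnS -addn1 modnDml addn1.
Qed.

Lemma eq_iter_ordS i m l : (m < n)%N -> (l < n)%N ->
  (iter m (@ordS n) i == iter l (@ordS n) i) = (m == l).
Proof.
by move=> mn ln; rewrite -val_eqE /= !val_iter_ordS eqn_modDl !modn_small.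
Qed.

Variable mu : probability (borel (ideal_ring R hn)) R.
Hypothesis dots_id : forall i j i' j' : 'I_n, i != j -> i' != j' ->
  identically_distributed (T' := R) mu
    (fun P : ideal_ring R hn => dot (edge i P) (edge j P))
    (fun P : ideal_ring R hn => dot (edge i' P) (edge j' P)).

(** By hypothesis the off-diagonal products share one mean [c], and the products
    of a fixed edge with all [n] edges sum to 0, whence [1 + (n - 1) * c = 0]. *)
Lemma has_mean_dot_edge i j :
  has_mean mu (fun P : ideal_ring R hn => dot (edge i P) (edge j P))
    (if i == j then 1 else - (n%:R - 1)^-1).
Proof.
have [i0 [i1 i01]] : exists i0 i1 : 'I_n, i0 != i1.
  by case: (n) hn => [|[|m]] // _; exists ord0, ord_max.
pose c := fine ('E_mu[fun P : ideal_ring R hn => dot (edge i0 P) (edge i1 P)])%E.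
have hm i' j' :=
  has_mean_bounded mu _ 1 (measurable_dot_edge i' j') (dot_edge_le1 i' j').
have {hm}hc i' j' : has_mean mu
    (fun P : ideal_ring R hn => dot (edge i' P) (edge j' P))
    (if i' == j' then 1 else c).
  have [<-|ij] := eqVneq i' j'.
    under [X in has_mean _ X]funext do rewrite dot_edge_diag.
    exact: has_mean_cst.
  have [iX _] := hm i' j'; have [i0X E0] := hm i0 i1; split=> //.
  by rewrite -E0; apply: expectation_identically_distributed;
    [exact: measurable_dot_edge.. | | | exact: dots_id].
suff -> : - (n%:R - 1)^-1 = c by exact: hc.
have := has_mean_sum mu _ (index_enum 'I_n) _ _ (hc i0).
under [X in has_mean _ X]funext do rewrite sum_dot_edge.
move=> /(has_mean_unique mu _ _ _ (has_mean_cst mu 0)).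
rewrite (bigD1 i0) //= eqxx.
under eq_bigr => j' /negPf do rewrite eq_sym => ->.
rewrite sumr_const cardC1 card_ord -subn1 -[c *+ _]mulr_natr natrB ?(leq_trans _ hn) //.
have n1 := subr1_neq0.
by move=> H; apply: (mulIf n1); rewrite mulNr mulVf //; lra.
Qed.

(** The value does not depend on the starting edge [i], so averaging over [i]
    leaves it unchanged. *)
Lemma has_mean_gyration2 i k : (0 < k < n)%N ->
  has_mean mu (fun P => gyration2 (subsegment P i) k)
    ((k%:R ^+ 2 - 1) * (2 * n%:R - k%:R) / (12 * k%:R * (n%:R - 1))).
Proof.
move=> /andP[k0 kn].
have k00 : k%:R != 0 :> R by rewrite pnatr_eq0 -lt0n.
have n1 := subr1_neq0.
have := sum_weight_form R k (- (n%:R - 1)^-1) k0.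
have -> : (1 - - (n%:R - 1)^-1) * ((k%:R ^+ 2 - 1) / (6 * k%:R)) +
    - (n%:R - 1)^-1 * ((k%:R ^+ 2 - 1) / 12) =
    (k%:R ^+ 2 - 1) * (2 * n%:R - k%:R) / (12 * k%:R * (n%:R - 1)) :> R.
  by field; rewrite n1.
move=> <-.
under [X in has_mean _ X]funext do rewrite gyration2_dot //.
apply: has_meanZ; apply: has_mean_sum => j; apply: has_mean_sum => m.
apply: has_mean_sum => l; apply: has_meanZ.
rewrite -(_ : (iter m (@ordS n) i == iter l (@ordS n) i) = (m == l)).
  exact: has_mean_dot_edge.
by apply: eq_iter_ordS; apply: ltn_trans kn.
Qed.

End edges.

Theorem theorem8 (R : realType) (n k : nat) (hn : (3 <= n)%N)
    (hk : (1 <= k < n)%N)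
    (mu : probability (borel (ideal_ring R hn)) R)
    (edges_id : forall i j : 'I_n,
       identically_distributed (T' := borel 'rV[R]_3) mu (edge i) (edge j))
    (dots_id : forall i j i' j' : 'I_n, i != j -> i' != j' ->
       identically_distributed (T' := R) mu
         (fun P : ideal_ring R hn => dot (edge i P) (edge j P))
         (fun P : ideal_ring R hn => dot (edge i' P) (edge j' P))) :
  'E_mu[mean_gyration2 k]%E =
    ((k%:R ^+ 2 - 1) * (2 * n%:R - k%:R) / (12 * k%:R * (n%:R - 1)))%:E.
Proof.
set rhs : R := (_ / _).
have n0 : n%:R != 0 :> R by rewrite pnatr_eq0 -lt0n (leq_trans _ hn).
have -> : rhs = n%:R^-1 * \sum_(i < n) rhs.
  by rewrite sumr_const card_ord -[rhs *+ n]mulr_natl mulKf.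
apply: (has_meanZ _ _ _ _ _).2; apply: has_mean_sum => i.
exact: has_mean_gyration2.
Qed.
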